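(* Let $x_1,x_2,y_1,y_2,u_1,u_2,v_1,v_2,p_{+1},p_{+2},p_{-1},p_{-2},q_{+1},q_{+2},q_{-1},q_{-2},s,\lambda$ and $\mathbf w=(w_\ell)_{\ell\ge0}$ be indeterminates, and for $n\ge0$ define the polynomial $\widehat Q_n=\widehat Q_n(x_1,x_2,y_1,y_2,u_1,u_2,v_1,v_2,\mathbf w,p_{+1},p_{+2},p_{-1},p_{-2},q_{+1},q_{+2},q_{-1},q_{-2},s,\lambda)$ by $$\begin{aligned}\widehat Q_n=\sum_{\sigma\in\mathfrak S_n}\;& x_1^{\mathrm{eareccpeak}(\sigma)}x_2^{\mathrm{eareccdfall}(\sigma)}y_1^{\mathrm{ereccval}(\sigma)}y_2^{\mathrm{ereccdrise}(\sigma)}\,u_1^{\mathrm{nrcpeak}(\sigma)}u_2^{\mathrm{nrcdfall}(\sigma)}v_1^{\mathrm{nrcval}(\sigma)}v_2^{\mathrm{nrcdrise}(\sigma)}\,\mathbf w^{\mathbf{fix}(\sigma)}\\ &\times p_{+1}^{\mathrm{ucrosscval}(\sigma)}p_{+2}^{\mathrm{ucrosscdrise}(\sigma)}p_{-1}^{\mathrm{lcrosscpeak}(\sigma)}p_{-2}^{\mathrm{lcrosscdfall}(\sigma)}\\ &\times q_{+1}^{\mathrm{unestcval}(\sigma)}q_{+2}^{\mathrm{unestcdrise}(\sigma)}q_{-1}^{\mathrm{lnestcpeak}(\sigma)}q_{-2}^{\mathrm{lnestcdfall}(\sigma)}s^{\mathrm{psnest}(\sigma)}\lambda^{\mathrm{cyc}(\sigma)}.\end{aligned}$$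 Then the ordinary generating function of the polynomials $\widehat Q_n$ specialized to $v_1=y_1$, $v_2=y_2$, $q_{+1}=p_{+1}$, $q_{+2}=p_{+2}$ has the J-type continued fraction $$\sum_{n=0}^\infty \widehat Q_n(x_1,x_2,y_1,y_2,u_1,u_2,y_1,y_2,\mathbf w,p_{+1},p_{+2},p_{-1},p_{-2},p_{+1},p_{+2},q_{-1},q_{-2},s,\lambda)\,t^n=\cfrac{1}{1-\gamma_0 t-\cfrac{\beta_1t^2}{1-\gamma_1t-\cfrac{\beta_2t^2}{1-\gamma_2 t-\cdots}}}$$ with coefficients $\gamma_0=\lambda w_0$ and, for $n\ge1$, $$\gamma_n=\bigl(p_{-2}^{n-1}x_2+q_{-2}[n-1]_{p_{-2},q_{-2}}u_2\bigr)+n\,p_{+2}^{n-1}y_2+\lambda s^nw_n,$$ $$\beta_n=(\lambda+n-1)\bigl(p_{-1}^{n-1}x_1+q_{-1}[n-1]_{p_{-1},q_{-1}}u_1\bigr)\,p_{+1}^{n-1}y_1.$$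
   Context: $[n]_{p,q}=\sum_{j=0}^{n-1}p^jq^{n-1-j}$ (so $[0]_{p,q}=0$). $\mathfrak S_n$ is the set of permutations of $[n]=\{1,\dots,n\}$. Continued fractions are identities of formal power series in $t$. For $\sigma\in\mathfrak S_n$, an index $i\in[n]$ is a record if $\sigma(j)<\sigma(i)$ for all $j<i$; an antirecord if $\sigma(j)>\sigma(i)$ for all $j>i$; an exclusive record if it is a record and not an antirecord; an exclusive antirecord if it is an antirecord and not a record; a neither-record-antirecord if it is neither a record nor an antirecord. An index $i$ is a cycle peak if $\sigma^{-1}(i)<i>\sigma(i)$; a cycle valley if $\sigma^{-1}(i)>i<\sigma(i)$; a cycle double rise if $\sigma^{-1}(i)<i<\sigma(i)$; a cycle double fall if $\sigma^{-1}(i)>i>\sigma(i)$; a fixed point if $\sigma(i)=i$. Statistics: $\mathrm{eareccpeak}(\sigma)$ [resp. $\mathrm{eareccdfall}(\sigma)$] is the number of exclusive antirecords that are also cycle peaks [resp. cycle double falls]; $\mathrm{ereccval}(\sigma)$ [resp. $\mathrm{ereccdrise}(\sigma)$] is the number of exclusive records that are also cycle valleys [resp. cycle double rises]; $\mathrm{nrcpeak},\mathrm{nrcval},\mathrm{nrcdrise},\mathrm{nrcdfall}$ are the numbers of neither-record-antirecords that are also cycle peaks, cycle valleys, cycle double rises, cycle double falls, respectively; $\mathrm{cyc}(\sigma)$ is the number of cycles (including fixed points). If $i$ is a fixed point, $\mathrm{lev}(i,\sigma)=\#\{j<i:\sigma(j)>i\}=\#\{j>i:\sigma(j)<i\}$,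 and $\mathbf w^{\mathbf{fix}(\sigma)}=\prod_{i:\,\sigma(i)=i}w_{\mathrm{lev}(i,\sigma)}$. Crossings and nestings: each of the following is the number of quadruplets $i<j<k<l$ in $[n]$ with the stated property. ucrosscval: $k=\sigma(i)$, $l=\sigma(j)$, $\sigma^{-1}(j)>j$. ucrosscdrise: $k=\sigma(i)$, $l=\sigma(j)$, $\sigma^{-1}(j)<j$. lcrosscpeak: $i=\sigma(k)$, $j=\sigma(l)$, $\sigma^{-1}(k)<k$. lcrosscdfall: $i=\sigma(k)$, $j=\sigma(l)$, $\sigma^{-1}(k)>k$. unestcval: $l=\sigma(i)$, $k=\sigma(j)$, $\sigma^{-1}(j)>j$. unestcdrise: $l=\sigma(i)$, $k=\sigma(j)$, $\sigma^{-1}(j)<j$. lnestcpeak: $i=\sigma(l)$, $j=\sigma(k)$, $\sigma^{-1}(k)<k$. lnestcdfall: $i=\sigma(l)$, $j=\sigma(k)$, $\sigma^{-1}(k)>k$. Finally $\mathrm{psnest}(\sigma)$ is the number of triplets $i<j<l$ with $\sigma(j)=j$ and $l=\sigma(i)$ (equivalently, the number of triplets $i<j<l$ with $\sigma(j)=j$ and $i=\sigma(l)$). *)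

(* Defs.v *)
From mathcomp Require Import all_boot all_order all_algebra all_fingroup.
From mathcomp Require Import zify.

Set Implicit Arguments.
Unset Strict Implicit.
Unset Printing Implicit Defensive.

(* Permutations of [n] = {1, ..., n} are represented by {perm 'I_n}, on
   {0, ..., n-1}; every statistic below depends only on the relative order of
   the indices, so the shift by one is harmless.  Comparisons between elements
   of 'I_n are those of the underlying natural numbers. *)

Section Statistics.

Variables (n : nat) (sigma : {perm 'I_n}).
Implicit Types i j k l : 'I_n.

Local Notation sigmaV := (sigma^-1)%g.

Definition record i := [forall j : 'I_n, (j < i) ==> (sigma j < sigma i)].
Definition antirecord i := [forall j : 'I_n, (i < j) ==> (sigma i < sigma j)].
Definition exrecord i := record i && ~~ antirecord i.
Definition exantirecord i := antirecord i && ~~ record i.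
Definition nrar i := ~~ record i && ~~ antirecord i.

Definition cpeak i := (sigmaV i < i) && (sigma i < i).
Definition cval i := (i < sigmaV i) && (i < sigma i).
Definition cdrise i := (sigmaV i < i) && (i < sigma i).
Definition cdfall i := (i < sigmaV i) && (sigma i < i).

Definition eareccpeak := #|[set i : 'I_n | exantirecord i && cpeak i]|.
Definition eareccdfall := #|[set i : 'I_n | exantirecord i && cdfall i]|.
Definition ereccval := #|[set i : 'I_n | exrecord i && cval i]|.
Definition ereccdrise := #|[set i : 'I_n | exrecord i && cdrise i]|.
Definition nrcpeak := #|[set i : 'I_n | nrar i && cpeak i]|.
Definition nrcdfall := #|[set i : 'I_n | nrar i && cdfall i]|.
Definition nrcval := #|[set i : 'I_n | nrar i && cval i]|.
Definition nrcdrise := #|[set i : 'I_n | nrar i && cdrise i]|.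

Definition cyc := #|porbits sigma|.

Definition lev i := #|[set j : 'I_n | (j < i) && (i < sigma j)]|.

Definition nquad (P : 'I_n -> 'I_n -> 'I_n -> 'I_n -> bool) :=
  #|[set x : 'I_n * 'I_n * 'I_n * 'I_n |
      let: (i, j, k, l) := x in [&& i < j, j < k, k < l & P i j k l]]|.

Definition ucrosscval := nquad (fun i j k l =>
  [&& k == sigma i, l == sigma j & j < sigmaV j]).
Definition ucrosscdrise := nquad (fun i j k l =>
  [&& k == sigma i, l == sigma j & sigmaV j < j]).
Definition lcrosscpeak := nquad (fun i j k l =>
  [&& i == sigma k, j == sigma l & sigmaV k < k]).
Definition lcrosscdfall := nquad (fun i j k l =>
  [&& i == sigma k, j == sigma l & k < sigmaV k]).
Definition unestcval := nquad (fun i j k l =>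
  [&& l == sigma i, k == sigma j & j < sigmaV j]).
Definition unestcdrise := nquad (fun i j k l =>
  [&& l == sigma i, k == sigma j & sigmaV j < j]).
Definition lnestcpeak := nquad (fun i j k l =>
  [&& i == sigma l, j == sigma k & sigmaV k < k]).
Definition lnestcdfall := nquad (fun i j k l =>
  [&& i == sigma l, j == sigma k & k < sigmaV k]).

Definition psnest :=
  #|[set x : 'I_n * 'I_n * 'I_n |
      let: (i, j, l) := x in
      [&& i < j, j < l, sigma j == j & l == sigma i]]|.

End Statistics.

Import GRing.Theory.
Local Open Scope ring_scope.

Definition pqint (R : comNzRingType) (p q : R) (n : nat) : R :=
  \sum_(j < n) p ^+ j * q ^+ (n.-1 - j).

Definition wfix (R : comNzRingType) (w : nat -> R) n (sigma : {perm 'I_n}) : R :=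
  \prod_(i | sigma i == i) w (lev sigma i).

Definition Qhat (R : comNzRingType)
    (x1 x2 y1 y2 u1 u2 v1 v2 : R) (w : nat -> R)
    (pp1 pp2 pm1 pm2 qp1 qp2 qm1 qm2 s lambda : R) (n : nat) : R :=
  \sum_(sigma : {perm 'I_n})
    (x1 ^+ eareccpeak sigma * x2 ^+ eareccdfall sigma
     * y1 ^+ ereccval sigma * y2 ^+ ereccdrise sigma
     * u1 ^+ nrcpeak sigma * u2 ^+ nrcdfall sigma
     * v1 ^+ nrcval sigma * v2 ^+ nrcdrise sigma
     * wfix w sigma
     * pp1 ^+ ucrosscval sigma * pp2 ^+ ucrosscdrise sigma
     * pm1 ^+ lcrosscpeak sigma * pm2 ^+ lcrosscdfall sigma
     * qp1 ^+ unestcval sigma * qp2 ^+ unestcdrise sigma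
     * qm1 ^+ lnestcpeak sigma * qm2 ^+ lnestcdfall sigma
     * s ^+ psnest sigma * lambda ^+ cyc sigma).

(* f : fps R is the formal power series \sum_n f n * t^n. *)
Definition fps (R : comNzRingType) := nat -> R.

Section FormalPowerSeries.

Variable R : comNzRingType.
Implicit Types (f g h : fps R) (c : R).

Definition fps_monom c (m : nat) : fps R := fun n => if n == m then c else 0.
Definition fps_add f g : fps R := fun n => f n + g n.
Definition fps_opp f : fps R := fun n => - f n.
Definition fps_mul f g : fps R := fun n => \sum_(i < n.+1) f i * g (n - i)%N.
Definition fps_exp h (k : nat) : fps R := iter k (fps_mul h) (fps_monom 1 0).

(* The inverse of 1 - h for a series h without constant term, as the geometric
   series \sum_k h^k; the terms k > n do not contribute to the coefficient of
   t^n.  See fps_inv1BP. *)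
Definition fps_inv1B h : fps R := fun n => \sum_(k < n.+1) fps_exp h k n.

(* Convergence in the t-adic topology: each coefficient is eventually constant. *)
Definition fps_cvg (F : nat -> fps R) f :=
  forall n, exists N0, forall N, (N0 <= N)%N -> F N n = f n.

(* Jconv gamma beta N k =
     1 / (1 - gamma_k t - beta_(k+1) t^2 /
            (1 - gamma_(k+1) t - beta_(k+2) t^2 / ...))
   truncated after N levels (gamma_k, ..., gamma_(k+N-1)); beta_0 is never
   used when k = 0. *)
Fixpoint Jconv (gamma beta : nat -> R) (N k : nat) : fps R :=
  if N is N'.+1 then
    fps_inv1B (fps_add (fps_monom (gamma k) 1)
                       (fps_mul (fps_monom (beta k.+1) 2)
                                (Jconv gamma beta N' k.+1)))
  else fps_monom 0 0.

Definition has_Jfraction f (gamma beta : nat -> R) :=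
  fps_cvg (fun N => Jconv gamma beta N 0) f.

Lemma fps_exp_lt h k n : h 0%N = 0 -> (n < k)%N -> fps_exp h k n = 0.
Proof.
move=> h0; elim: k n => // k IHk n ltnk.
rewrite /fps_exp iterS; apply: big1 => -[[|i] lti] _ /=.
  by rewrite h0 mul0r.
by rewrite -/(fps_exp h k) IHk ?mulr0 //; lia.
Qed.

Lemma fps_inv1BP h : h 0%N = 0 ->
  fps_mul (fps_add (fps_monom 1 0) (fps_opp h)) (fps_inv1B h)
  =1 fps_monom 1 0.
Proof.
move=> h0 n; rewrite /fps_mul /fps_add /fps_opp.
under eq_bigr do rewrite mulrDl mulNr.
rewrite big_split /= sumrN big_ord_recl /= mul1r subn0 big1 ?addr0; last first.
  by move=> i _; rewrite /fps_monom /= mul0r.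
have -> : \sum_(i < n.+1) h i * fps_inv1B h (n - i)%N
          = \sum_(k < n.+1) fps_exp h k.+1 n.
  rewrite /fps_exp; under [RHS]eq_bigr do rewrite iterS -/(fps_exp h _).
  rewrite /fps_mul exchange_big /=; apply: eq_bigr => i _.
  rewrite -mulr_sumr /fps_inv1B; congr (_ * _).
  rewrite -!(big_mkord xpredT (fun k => fps_exp h k (n - i)%N)).
  rewrite [RHS](@big_cat_nat _ _ _ (n - i).+1) //=; last by lia.
  rewrite [X in _ = _ + X]big_nat_cond [X in _ = _ + X]big1 ?addr0 // => k.
  by rewrite andbT => /andP[ltk _]; exact: fps_exp_lt.
rewrite /fps_inv1B big_ord_recl big_ord_recr [X in _ - (_ + X)]fps_exp_lt //.
by rewrite addr0 addrK.
Qed.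

End FormalPowerSeries.

(* Main.v *)
Require Import Defs.
From mathcomp Require Import all_boot all_order all_algebra all_fingroup.
From mathcomp Require Import zify ring.

(** The proof has a combinatorial half and a formal one.

    Call a path or cycle of [sigma] the corresponding chain of arrows
    [i -> sigma i].  The idea is to reveal [sigma] index by index: after the
    first [m] indices one knows the arrows between two indices below [m], and
    these arrows form cycles and [k] paths; each path has a start that still
    waits for a preimage and an end that still waits for an image.  The next
    index [m] is a cycle valley (it opens a path, [k] increases), a fixed
    point, a cycle double rise (it is appended to one of the [k] paths), a
    cycle double fall (it is put in front of one of the [k] paths) or a cycle
    peak (it is put after the end of a path and before the start of a path, [k]
    decreases).  So one reads off a Motzkin path, whose height is [k], and the
    point is that the total weight of the choices at each step only depends on
    [k]:
    - if [m] is put in front of the path with start [b], the starts smaller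
      than [b] are the lower nestings of [m] and those larger than [b] its
      lower crossings, and [m] is an antirecord iff there is no smaller start
      ([antirecord_antiexc]); the sum over [b] gives
      p^(k-1) x + q [k-1]_{p,q} u;
    - an index [j] with [j < sigma j] is never an antirecord, and its upper
      crossings and nestings together are the indices [i < j] with
      [sigma i > j], whose number is given by the height ([upper_quads],
      [lev_depth]); here the specialisation of the parameters is used, and it
      is the reason why it does not matter to the weight which of the [k] ends
      is followed by [m];
    - hence, for a cycle peak with a given [b], the [k] ends have the same
      weight, except that the end of the path of [b] itself closes a cycle:
      this gives the factor [lambda + k - 1].

    To avoid partial permutations, revealed paths are contracted to a single
    point, named by the start of the path: instead of partial permutations one
    considers the permutations [sigma] that fix every index below [m] outside
    a set [O] of [k] path names and send [O] to indices [>= m] ([collapsed]).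
    A step then amounts to multiplying by transpositions.  The weight of an
    index [i] only depends on the images of the indices [>= i]
    ([weight_local]), hence is not affected by the contractions, and the effect
    of a transposition on the number of cycles is known.  Descending induction
    on [m] shows that the total weight of such [sigma] is the generating
    function of the Motzkin paths from height [k] to 0 ([completions_motzkin]);
    [stat_weight_prod] identifies the summand of the theorem with the product
    of the local weights.

    The formal half is the expansion of the generating function of weighted
    Motzkin paths as a J-fraction ([motzkin_Jfraction]). *)

Set Implicit Arguments.
Unset Strict Implicit.
Unset Printing Implicit Defensive.

Import GRing.Theory.
Local Open Scope ring_scope.

(** * Motzkin paths and J-fractions *)

Section JFraction.

Variable R : comNzRingType.
Implicit Types f g h : fps R.

Lemma fps_mul_coef f g n K : (n < K)%N ->
  fps_mul f g n = ((\poly_(i < K) f i) * (\poly_(i < K) g i))`_n.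
Proof.
move=> ltnK; rewrite coefM; apply: eq_bigr => i _; rewrite !coef_poly.
by rewrite !ifT //; have := ltn_ord i; lia.
Qed.

Lemma fps_mulC f g : fps_mul f g =1 fps_mul g f.
Proof. by move=> n; rewrite !(@fps_mul_coef _ _ n n.+1) // mulrC. Qed.

Lemma fps_mulA f g h : fps_mul f (fps_mul g h) =1 fps_mul (fps_mul f g) h.
Proof.
move=> n; pose P f := \poly_(i < n.+1) f i.
transitivity (P f * (P g * P h))`_n.
  rewrite coefM; apply: eq_bigr => i _; have := ltn_ord i => lti.
  by rewrite coef_poly ifT // -fps_mul_coef //; lia.
rewrite mulrA coefM; apply: eq_bigr => i _; have := ltn_ord i => lti.
by rewrite -fps_mul_coef // coef_poly ifT //; lia.
Qed.

Lemma fps_mulCA f g h : fps_mul f (fps_mul g h) =1 fps_mul g (fps_mul f h).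
Proof.
move=> n; rewrite !fps_mulA; apply: eq_bigr => i _; congr (_ * _).
exact: fps_mulC.
Qed.

Lemma fps_mulDl f g h n :
  fps_mul (fps_add f g) h n = fps_mul f h n + fps_mul g h n.
Proof. by rewrite -big_split; apply: eq_bigr => i _; rewrite mulrDl. Qed.

Lemma fps_mul_monom (c : R) m f n :
  fps_mul (fps_monom c m) f n = if (m <= n)%N then c * f (n - m)%N else 0.
Proof.
rewrite /fps_mul /fps_monom; case: leqP => [lemn | ltnm].
  have ltm : (m < n.+1)%N by lia.
  rewrite (bigD1 (Ordinal ltm)) //= eqxx big1 ?addr0 // => i.
  by rewrite -val_eqE /= => /negPf->; rewrite mul0r.
by apply: big1 => i _; rewrite ifF ?mul0r //; have := ltn_ord i; lia.
Qed.

Lemma fps_inv1B_fixpoint h g n : h 0%N = 0 ->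
  fps_mul (fps_inv1B h) g n = g n + fps_mul h (fps_mul (fps_inv1B h) g) n.
Proof.
move=> h0; have invE i :
    fps_inv1B h i = fps_monom 1 0 i + fps_mul h (fps_inv1B h) i.
  rewrite -(fps_inv1BP h0) fps_mulDl fps_mul_monom /= mul1r subn0.
  rewrite -addrA [X in _ + X](_ : _ = 0) ?addr0 //.
  by rewrite -big_split big1 // => j _ /=; rewrite /fps_opp mulNr addNr.
have -> : g n = fps_mul (fps_monom 1 0) g n.
  by rewrite fps_mul_monom mul1r subn0.
rewrite fps_mulA -fps_mulDl.
by apply: eq_bigr => i _; rewrite /fps_add -invE.
Qed.

(** A series with [f = g + h f] is [g / (1 - h)], also when the equation is only
    known modulo a power of [t]: as [h] has no constant term, the equation
    determines the coefficients of [f] one after the other. *)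
Lemma fps_inv1B_unique h f g K : h 0%N = 0 ->
    (forall n, (n <= K)%N -> f n = g n + fps_mul h f n) ->
  forall n, (n <= K)%N -> f n = fps_mul (fps_inv1B h) g n.
Proof.
move=> h0 eqf; elim/ltn_ind=> n IHn lenK.
rewrite eqf // fps_inv1B_fixpoint //; congr (_ + _).
apply: eq_bigr => -[[|i] lti] _ /=; first by rewrite h0 !mul0r.
by rewrite IHn //; lia.
Qed.

Variables up lv dn : nat -> R.

(** Weighted Motzkin paths with [n] steps from height [k] to height 0.  The
    predecessor of 0 being 0, a vanishing [dn 0] is what keeps the paths at
    nonnegative heights. *)
Fixpoint motzkin n k : R :=
  if n is n'.+1 then
    up k * motzkin n' k.+1 + lv k * motzkin n' k + dn k * motzkin n' k.-1
  else (k == 0)%:R.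

Variables gamma beta : nat -> R.
Hypotheses (gammaE : gamma =1 lv)
           (betaE : forall k, beta k.+1 = up k * dn k.+1).

Let tail N k := fps_add (fps_monom (gamma k) 1)
                  (fps_mul (fps_monom (beta k.+1) 2) (Jconv gamma beta N k.+1)).

Let tail0 N k : tail N k 0%N = 0.
Proof. by rewrite /tail /fps_add fps_mul_monom /= addr0. Qed.

Let tail_mul N k f n : fps_mul (tail N k) f n.+1 = gamma k * f n +
  up k * fps_mul (Jconv gamma beta N k.+1)
                 (fps_mul (fps_monom (dn k.+1) 1) f) n.
Proof.
rewrite fps_mulDl fps_mul_monom /= subn1 -fps_mulA [in RHS]fps_mulCA.
rewrite !fps_mul_monom.
case: n => [|n]; first by rewrite mulr0.
by rewrite /= betaE mulrA !subSS !subn0.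
Qed.

(** Splitting a path from height [k+1] at its first visit to height [k]; the
    part before it stays above [k] and is counted by the continued fraction
    that starts at level [k+1]. *)
Lemma motzkin_first_passage N k n : (n <= N)%N ->
  motzkin n k.+1 = fps_mul (Jconv gamma beta N k.+1)
    (fps_mul (fps_monom (dn k.+1) 1) (fun m => motzkin m k)) n.
Proof.
elim: N k n => [|N IHN] k n.
  rewrite leqn0 => /eqP->; rewrite /fps_mul big_ord1 /= /fps_monom /=.
  by rewrite mul0r.
apply: (@fps_inv1B_unique (tail N k.+1) (fun m => motzkin m k.+1)) => //.
move=> {}n; case: n => [|n] len.
  by rewrite fps_mul_monom /fps_mul big_ord1 tail0 mul0r addr0.
by rewrite tail_mul -IHN // fps_mul_monom /= subn1 gammaE; ring.
Qed.

Theorem motzkin_Jfraction : dn 0%N = 0 ->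
  has_Jfraction (fun n => motzkin n 0) gamma beta.
Proof.
move=> dn0 n; exists n.+1 => -[|N] // lenN.
pose f m := motzkin m 0.
rewrite [RHS](@fps_inv1B_unique (tail N 0) f (fps_monom 1 0) n) //.
- by rewrite fps_mulC fps_mul_monom /= mul1r subn0.
- move=> [|m] lem; first by rewrite /fps_mul big_ord1 tail0 mul0r addr0.
  rewrite tail_mul -motzkin_first_passage; last by lia.
  by rewrite /f /= dn0 gammaE /fps_monom /=; ring.
Qed.

End JFraction.

(** * Ordinals and their permutations *)

Lemma ltn_neq_ord n (i j : 'I_n) : j != i -> (i <= j)%N -> (i < j)%N.
Proof. by rewrite ltn_neqAle eq_sym => ->. Qed.

Lemma perm_inv_eq n (sigma : {perm 'I_n}) i j :
  ((sigma^-1)%g i == j) = (sigma j == i).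
Proof. by rewrite -(inj_eq (@perm_inj _ sigma)) permKV eq_sym. Qed.

Lemma card_ord_lt n m : (m <= n)%N -> #|[set i : 'I_n | (i < m)%N]| = m.
Proof.
move=> lemn; rewrite -sum1dep_card -(big_ord_widen n (fun=> 1%N)) //.
by rewrite sum1_card card_ord.
Qed.

(** For summing over the paths that a new index can be put in front of: the
    lower crossings and nestings created by the choice of [b] in [O] are the
    elements of [O] above and below [b]. *)
Lemma sum_by_rank (V : nmodType) n (O : {set 'I_n}) (f : nat -> nat -> V) :
  \sum_(b in O) f #|[set o in O | (b < o)%N]| #|[set o in O | (o < b)%N]|
    = \sum_(r < #|O|) f (#|O|.-1 - r)%N r.
Proof.
have [k] := ubnP #|O|; elim: k O f => // k IHk O f leOk.
have [->|/set0Pn[b0 b0O]] := eqVneq O set0.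
  by rewrite cards0 big_set0 big_ord0.
case: (arg_maxnP (fun i : 'I_n => i : nat) b0O) => b bO bmax.
have {}bO : b \in O := bO.
have {}bmax o : o \in O -> (o <= b)%N by move/bmax.
have lt_b o : o \in O :\ b -> (o < b)%N.
  by rewrite !inE -val_eqE /= => /andP[neq /bmax]; lia.
have cardO : #|O| = #|O :\ b|.+1 by rewrite (cardsD1 b) bO.
rewrite (big_setD1 b) //= cardO big_ord_recr addrC /=; congr (_ + _);
  last first.
  rewrite subnn; congr f.
    by apply: eq_card0 => o; rewrite !inE; apply/andP => -[/bmax]; lia.
  apply: eq_card => o; rewrite !inE -val_eqE /=.
  by case: (boolP (o \in O)) => [/bmax|] /=; lia.
transitivity (\sum_(c in O :\ b) f #|[set o in O :\ b | (c < o)%N]|.+1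
                                   #|[set o in O :\ b | (o < c)%N]|).
  apply: eq_bigr => c /lt_b ltcb; congr f.
    rewrite (cardsD1 b) inE bO ltcb; congr _.+1.
    by apply: eq_card => o; rewrite !inE andbA.
  apply: eq_card => o; rewrite !inE -val_eqE /=.
  by case: (o \in O); rewrite ?andbF // !andbT /=; lia.
rewrite (IHk _ (fun i => f i.+1)); last by lia.
by apply: eq_bigr => -[r /= ltr] _; congr f; lia.
Qed.

(** * Local weights *)

Section LocalStatistics.

Variables (n : nat) (sigma : {perm 'I_n}).
Implicit Types i j : 'I_n.

(** Like the other two statistics of this section, the depth only looks at
    the images of the indices [>= i], which makes [weight_local] possible.  It
    is related to [lev] by [lev_depth]. *)
Definition depth i := #|[set j : 'I_n | (i < j)%N && (sigma j < i)%N]|.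
Definition lcross i :=
  #|[set j : 'I_n | [&& (i < j)%N, (sigma j < i)%N & (sigma i < sigma j)%N]]|.
Definition lnest i :=
  #|[set j : 'I_n | [&& (i < j)%N, (sigma j < i)%N & (sigma j < sigma i)%N]]|.

End LocalStatistics.

Section LocalWeight.

Variables (R : comNzRingType) (x1 x2 y1 y2 u1 u2 : R) (w : nat -> R).
Variables (pp1 pp2 pm1 pm2 qm1 qm2 s : R).

(** The factor of an index [i] with [sigma i < i], with [c] lower crossings and
    [d] lower nestings; [d == 0] singles out the antirecords. *)
Definition low_weight (p q x u : R) (c d : nat) : R :=
  (if d == 0 then x else u) * p ^+ c * q ^+ d.

(** The contribution of the index [i] to the summand, apart from the cycles.
    The crossings and nestings of an index with [i < sigma i] are counted by
    [lev], which by [lev_depth] is [depth - 1] for a cycle double rise and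
    [depth] for a cycle valley. *)
Definition weight n (sigma : {perm 'I_n}) (i : 'I_n) : R :=
  if sigma i == i then w (depth sigma i) * s ^+ depth sigma i
  else if (i < sigma i)%N then
    if (i < (sigma^-1)%g i)%N then y1 * pp1 ^+ depth sigma i
    else y2 * pp2 ^+ (depth sigma i).-1
  else
    if (i < (sigma^-1)%g i)%N
    then low_weight pm2 qm2 x2 u2 (lcross sigma i) (lnest sigma i)
    else low_weight pm1 qm1 x1 u1 (lcross sigma i) (lnest sigma i).

(** Even whether the preimage of [i] lies above [i] can be read off the images
    of the indices [>= i].  This is why contracting arrows below [i] does not
    change the weight of [i]. *)
Lemma weight_local n (sigma tau : {perm 'I_n}) (i : 'I_n) :
  (forall j : 'I_n, (i <= j)%N -> sigma j = tau j) ->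
  weight sigma i = weight tau i.
Proof.
move=> eq_st.
have eq_cards (P : pred 'I_n) :
    #|[set j : 'I_n | (i < j)%N && P (sigma j)]|
      = #|[set j : 'I_n | (i < j)%N && P (tau j)]|.
  by apply: eq_card => j; rewrite !inE; case: ltnP => // /ltnW/eq_st->.
have eqi := eq_st i (leqnn i).
have eqV : (i < (sigma^-1)%g i)%N = (i < (tau^-1)%g i)%N.
  apply/idP/idP => lti.
    by rewrite -{2}(permKV sigma i) eq_st ?permK // ltnW.
  by rewrite -{2}(permKV tau i) -eq_st ?permK // ltnW.
have eqd : depth sigma i = depth tau i := eq_cards (fun k => k < i)%N.
have eqc : lcross sigma i = lcross tau i.
  by rewrite /lcross eqi (eq_cards (fun k => (k < i) && (tau i < k))%N).
have eqn : lnest sigma i = lnest tau i.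
  by rewrite /lnest eqi (eq_cards (fun k => (k < i) && (k < tau i))%N).
by rewrite /weight eqV eqd eqc eqn eqi.
Qed.

End LocalWeight.

(** * Contracting the paths below an index *)

(** The permutations left after contracting the paths below [m]; [O] consists
    of the starts of these paths, and the image of a path name is the image of
    the end of the path.  The indices below [m] outside [O] have been used up
    and become fixed points, so that no change of index set is necessary. *)
Definition collapsed n m (O : {set 'I_n}) (sigma : {perm 'I_n}) :=
  [forall i : 'I_n, (i < m)%N ==>
     if i \in O then (m <= sigma i)%N else sigma i == i].

Lemma collapsedP n m (O : {set 'I_n}) (sigma : {perm 'I_n}) :
  reflect (forall i : 'I_n, (i < m)%N ->
             if i \in O then (m <= sigma i)%N else sigma i == i)
          (collapsed m O sigma).
Proof. by apply: (iffP forallP) => H i; apply/implyP/H. Qed.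

Section Step.

Variables (n : nat) (m : 'I_n) (O : {set 'I_n}).
Hypothesis ltO : forall o, o \in O -> (o < m)%N.

(** The targets below [m] of the indices above [m] are exactly the path names,
    except the one that [m] itself is put in front of. *)
Lemma collapsed_card sigma (Q : pred 'I_n) : collapsed m O sigma ->
  #|[set j : 'I_n | [&& (m < j)%N, (sigma j < m)%N & Q (sigma j)]]|
    = #|[set o in O | Q o & o != sigma m]|.
Proof.
move=> /collapsedP V.
rewrite -(card_preimset [set o in O | Q o & o != sigma m] (@perm_inj _ sigma)).
apply: eq_card => j; rewrite !inE (inj_eq perm_inj).
case: (ltngtP m j) => [ltmj|ltjm|/val_inj <-] /=; last 2 first.
- have := V j ltjm; case: ifP => [jO|/negbT jO /eqP->];
    last by rewrite (negPf jO).
  by case: (boolP (sigma j \in O)) => // /ltO; lia.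
- by rewrite eqxx !andbF.
rewrite -val_eqE /= neq_ltn ltmj orbT andbT; congr (_ && _).
apply/idP/idP => [ltm|/ltO//]; have := V _ ltm; case: ifP => // _.
by rewrite (inj_eq perm_inj) => /eqP eqj; move: ltm; rewrite eqj; lia.
Qed.

Lemma collapsed_depth sigma : collapsed m O sigma ->
  depth sigma m = #|O :\ sigma m|.
Proof.
move=> V; rewrite -[LHS]/(#|[set j : 'I_n | _ && _]|).
transitivity #|[set j : 'I_n | [&& (m < j)%N, (sigma j < m)%N & true]]|.
  by apply: eq_card => j; rewrite !inE andbT.
rewrite (collapsed_card xpredT) //; apply: eq_card => o; rewrite !inE.
exact: andbC.
Qed.

Lemma collapsed_lcross sigma : collapsed m O sigma ->
  lcross sigma m = #|[set o in O | (sigma m < o)%N]|.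
Proof.
move=> V; rewrite /lcross (collapsed_card (fun o => (sigma m < o)%N)) //.
apply: eq_card => o; rewrite !inE -val_eqE /=; congr (_ && _); lia.
Qed.

Lemma collapsed_lnest sigma : collapsed m O sigma ->
  lnest sigma m = #|[set o in O | (o < sigma m)%N]|.
Proof.
move=> V; rewrite /lnest (collapsed_card (fun o => (o < sigma m)%N)) //.
apply: eq_card => o; rewrite !inE -val_eqE /=; congr (_ && _); lia.
Qed.

(** In each of the next five lemmas, [m] is contracted.  A cycle valley becomes
    a new path consisting of [m] alone. *)
Lemma collapsed_valley (sigma : {perm 'I_n}) :
  [&& collapsed m O sigma, m < sigma m & m < (sigma^-1)%g m]%N
    = collapsed m.+1 (m |: O) sigma.
Proof.
apply/and3P/collapsedP => [[/collapsedP V ltm ltVm] i | V].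
  rewrite ltnS in_setU1 leq_eqVlt val_eqE; case: eqVneq => [->//|neqi] /= lti.
  have := V i lti; case: ifP => // _.
  rewrite leq_eqVlt => /orP[/eqP/val_inj eqm|//].
  by move: ltVm lti; rewrite eqm permK; lia.
have ltm : (m < sigma m)%N by have := V m; rewrite setU11 leqnn; apply.
split=> //.
  apply/collapsedP => i lti; have := V i (ltnW lti).
  rewrite in_setU1 -val_eqE /= (ltn_eqF lti) /=; case: ifP => // _; exact: ltnW.
rewrite ltnNge -ltnS; apply/negP => lti; have := V _ lti.
rewrite permKV ltnn; case: ifP => // /negP nO /eqP eqm.
by case: nO; rewrite -eqm setU11.
Qed.

Lemma collapsed_fixed (sigma : {perm 'I_n}) :
  collapsed m O sigma && (sigma m == m) = collapsed m.+1 O sigma.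
Proof.
have mO : m \notin O by apply/negP => /ltO; rewrite ltnn.
apply/andP/collapsedP => [[/collapsedP V fm] i | V].
  rewrite ltnS leq_eqVlt val_eqE; case: eqVneq => [->|neqi] /= lti.
    by rewrite (negPf mO).
  have := V i lti; case: ifP => // _.
  rewrite leq_eqVlt => /orP[/eqP/val_inj eqm|//].
  by case/eqP: neqi; apply: (@perm_inj _ sigma); rewrite (eqP fm) -eqm.
split; last by have := V m (leqnn _); rewrite (negPf mO).
apply/collapsedP => i lti; have := V i (ltnW lti).
by case: ifP => // _; exact: ltnW.
Qed.

(** [m] is appended to the path of [a], which keeps its start. *)
Lemma collapsed_drise a (sigma : {perm 'I_n}) : a \in O ->
  [&& collapsed m O (tperm a m * sigma)%g, m < (tperm a m * sigma)%g m
    & ((tperm a m * sigma)^-1)%g m == a]%N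
    = collapsed m.+1 O sigma.
Proof.
move=> aO; have ltam := ltO aO.
have mO : m \notin O by apply/negP => /ltO; rewrite ltnn.
rewrite perm_inv_eq !permM tpermL tpermR.
apply/and3P/collapsedP => [[/collapsedP V ltm /eqP sm] i | V].
  rewrite ltnS leq_eqVlt val_eqE; case: eqVneq => [->|neqi] /= lti.
    by rewrite (negPf mO) sm.
  have := V i lti; rewrite permM.
  case: (eqVneq i a) => [->|neqa]; first by rewrite aO.
  rewrite tpermD 1?eq_sym //; case: ifP => // _.
  by apply: ltn_neq_ord; rewrite -sm (inj_eq perm_inj).
have sm : sigma m = m by have := V m (leqnn _); rewrite (negPf mO) => /eqP.
have sa : (m < sigma a)%N by have := V a (ltnW ltam); rewrite aO.
split=> //; last by rewrite sm.
apply/collapsedP => i lti; have := V i (ltnW lti); rewrite permM.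
case: (eqVneq i a) => [->|neqa]; first by rewrite aO tpermL sm.
rewrite tpermD 1?eq_sym //; last by rewrite -val_eqE /= (ltn_eqF lti).
by case: ifP => // _; exact: ltnW.
Qed.

(** [m] is put in front of the path of [b]; the start of the path, hence its
    name, is now [m].  Renaming matters: the crossings and nestings of later
    indices depend on the order of the starts. *)
Lemma collapsed_dfall b (sigma : {perm 'I_n}) : b \in O ->
  [&& collapsed m O (tperm m b * sigma)%g, (tperm m b * sigma)%g m == b
    & m < ((tperm m b * sigma)^-1)%g m]%N
    = collapsed m.+1 (m |: O :\ b) sigma.
Proof.
move=> bO; have ltbm := ltO bO.
set tau := (tperm m b * sigma)%g.
have tm : tau m = sigma b by rewrite permM tpermL.
have tb : tau b = sigma m by rewrite permM tpermR.
have tD i : i != m -> i != b -> tau i = sigma i.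
  by move=> neqm neqb; rewrite permM tpermD 1?eq_sym.
rewrite tm.
apply/and3P/collapsedP => [[/collapsedP V sb ltm] i | V].
  have neqm (j : 'I_n) : (j <= m)%N -> tau j != m.
    rewrite leqNgt; apply: contra => /eqP eqj.
    by rewrite -(permK tau j) eqj.
  rewrite ltnS leq_eqVlt val_eqE; case: eqVneq => [->|neqi] /= lti.
    have := V b ltbm; rewrite setU11 bO tb; have := neqm b (ltnW ltbm).
    by rewrite tb; exact: ltn_neq_ord.
  rewrite !inE (negPf neqi) /=; case: eqVneq => [->//|neqb] /=.
  have := V i lti; have := neqm i (ltnW lti); rewrite tD //.
  by case: ifP => // _; exact: ltn_neq_ord.
have sb : sigma b == b.
  have := V b (ltnW ltbm); rewrite !inE eqxx /= orbF ifF //.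
  by rewrite -val_eqE /= ltn_eqF.
have sm : (m < sigma m)%N by have := V m (leqnn _); rewrite setU11.
have V' (i : 'I_n) : (i < m)%N -> i != b ->
    if i \in O then (m < tau i)%N else tau i == i.
  move=> lti neqb; have neqm : i != m by rewrite -val_eqE /= ltn_eqF.
  by have := V i (ltnW lti); rewrite !inE neqb (negPf neqm) tD.
split=> //.
  apply/collapsedP => i lti.
  case: (eqVneq i b) => [->|/(V' i lti)]; first by rewrite bO tb ltnW.
  by case: ifP => // _; exact: ltnW.
rewrite ltnNge leq_eqVlt val_eqE perm_inv_eq tm (eqP sb).
rewrite -val_eqE /= (ltn_eqF ltbm) /=; apply/negP => lti.
have := V' _ lti; rewrite perm_inv_eq tb -val_eqE /= (gtn_eqF sm) => /(_ isT).
rewrite permKV ltnn; case: ifP => // _ /eqP eqm.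
by move: lti; rewrite -eqm ltnn.
Qed.

(** The path of [a], then [m], then the path of [b] are joined to a path with
    start [a].  If [a = b], they form a cycle instead, and [a] is used up; the
    second transposition is then trivial, so that one formula covers both
    cases. *)
Lemma collapsed_peak a b (sigma : {perm 'I_n}) : a \in O -> b \in O ->
  [&& collapsed m O (tperm a m * (tperm a b * sigma))%g,
      (tperm a m * (tperm a b * sigma))%g m == b
    & ((tperm a m * (tperm a b * sigma))^-1)%g m == a]
    = collapsed m.+1 (O :\ b) sigma.
Proof.
move=> aO bO; have ltam := ltO aO; have ltbm := ltO bO.
have mO : m \notin O by apply/negP => /ltO; rewrite ltnn.
set tau := (tperm a m * (tperm a b * sigma))%g.
have neqam : a != m by rewrite -val_eqE /= ltn_eqF.
have neqbm : b != m by rewrite -val_eqE /= ltn_eqF.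
have tm : tau m = sigma b by rewrite !permM tpermR tpermL.
have ta : tau a = sigma m by rewrite !permM tpermL tpermD.
have tb : a != b -> tau b = sigma a.
  by move=> neq; rewrite !permM (@tpermD _ a m b neq) ?tpermR // eq_sym.
have tD i : i != m -> i != a -> i != b -> tau i = sigma i.
  by move=> neqm neqa neqb; rewrite !permM !tpermD 1?eq_sym.
rewrite perm_inv_eq tm ta; clearbody tau.
apply/and3P/collapsedP => [[/collapsedP V sb /eqP sm] i | V].
  rewrite ltnS leq_eqVlt val_eqE; case: eqVneq => [->|neqi] /= lti.
    by rewrite !inE (negPf mO) andbF sm.
  have neq_m : sigma i != m by rewrite -sm (inj_eq perm_inj).
  rewrite !inE; case: eqVneq => [->//|neqb] /=.
  case: (eqVneq i a) neqb neq_m => [->|neqa] neqb neq_m.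
    have := V b ltbm; rewrite aO bO tb //.
    exact: ltn_neq_ord.
  have := V i lti; rewrite tD //.
  by case: ifP => // _; exact: ltn_neq_ord.
have sb : sigma b == b by have := V b (ltnW ltbm); rewrite !inE eqxx.
have sm : sigma m == m.
  by have := V m (leqnn _); rewrite !inE (negPf mO) andbF.
split=> //; apply/collapsedP => i lti.
have neqm : i != m by rewrite -val_eqE /= ltn_eqF.
case: (eqVneq i a) => [->|neqa]; first by rewrite aO ta (eqP sm).
case: (eqVneq i b) => [eqb|neqb].
  move: neqa; rewrite eqb bO eq_sym => neqab; rewrite tb //.
  by have := V a (ltnW ltam); rewrite !inE neqab aO => /ltnW.
have := V i (ltnW lti); rewrite !inE neqb tD //=.
by case: ifP => // _; exact: ltnW.
Qed.

End Step.

(** * Cycles *)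

(** The transposition inserts the fixed point [y] into the cycle of [x]. *)
Lemma cyc_tperm_fixed n (sigma : {perm 'I_n}) x y :
  sigma y = y -> x != y -> cyc sigma = (cyc (tperm x y * sigma)%g).+1.
Proof.
move=> fy neq; have := porbits_mul_tperm sigma x y.
have -> : x \notin porbit sigma y.
  apply/negP => /porbitP[i]; rewrite permX iter_fix // => eqx.
  by rewrite eqx eqxx in neq.
by rewrite neq /cyc /=; lia.
Qed.

Lemma leq_fixed_cyc n (sigma : {perm 'I_n}) (A : {set 'I_n}) :
  (forall i, i \in A -> sigma i = i) -> (#|A| <= cyc sigma)%N.
Proof.
move=> fA; rewrite -(@card_in_imset _ _ (porbit sigma) A).
  by apply/subset_leq_card/subsetP => _ /imsetP[i _ ->]; exact: imset_f.
move=> i j iA jA /eqP; rewrite eq_porbit_mem => /porbitP[k].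
by rewrite permX iter_fix // fA.
Qed.

Section Completions.

Variables (R : comNzRingType) (x1 x2 y1 y2 u1 u2 : R) (w : nat -> R).
Variables (pp1 pp2 pm1 pm2 qm1 qm2 s lambda : R).

Local Notation weight :=
  (weight x1 x2 y1 y2 u1 u2 w pp1 pp2 pm1 pm2 qm1 qm2 s).

(** By [low_sumS] this is [p^(k-1) x + q [k-1]_{p,q} u] for positive [k]. *)
Definition low_sum (p q x u : R) k :=
  \sum_(r < k) low_weight p q x u (k.-1 - r) r.

Lemma low_sum0 p q x u : low_sum p q x u 0 = 0.
Proof. by rewrite /low_sum big_ord0. Qed.

Lemma low_sumS p q x u k :
  low_sum p q x u k.+1 = p ^+ k * x + q * pqint p q k * u.
Proof.
rewrite /low_sum big_ord_recl /low_weight /= subn0 mulr1 mulrC; congr (_ + _).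
rewrite /pqint mulr_sumr mulr_suml (reindex_inj rev_ord_inj).
apply: eq_bigr => i _; have lti := ltn_ord i.
rewrite (_ : bump 0 _ = (k.-1 - i).+1)%N; last by rewrite /bump /=; lia.
rewrite (_ : k - _ = i)%N; last by lia.
by rewrite exprS; move: (p ^+ i) (q ^+ _) => a b; ring.
Qed.

Definition up k := y1 * pp1 ^+ k.
Definition level k :=
  low_sum pm2 qm2 x2 u2 k + k%:R * pp2 ^+ k.-1 * y2 + lambda * s ^+ k * w k.
Definition down k := (lambda + k.-1%:R) * low_sum pm1 qm1 x1 u1 k.

Definition tail_weight n m (sigma : {perm 'I_n}) :=
  \prod_(i : 'I_n | (m <= i)%N) weight sigma i.

(** The exponent leaves out the [m - #|O|] cycles that are fixed points below
    [m] outside [O]; [collapsed_cyc] says that the subtraction is not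
    truncated. *)
Definition completions n m (O : {set 'I_n}) :=
  \sum_(sigma | collapsed m O sigma)
     lambda ^+ (cyc sigma - (m - #|O|)) * tail_weight m sigma.

Lemma collapsed_cyc n m (O : {set 'I_n}) sigma : (m <= n)%N ->
    (forall o, o \in O -> (o < m)%N) ->
  collapsed m O sigma -> (m - #|O| <= cyc sigma)%N.
Proof.
move=> lemn ltO /collapsedP V.
have <- : #|[set i : 'I_n | (i < m)%N] :\: O| = (m - #|O|)%N.
  rewrite cardsD card_ord_lt // (setIidPr _) //.
  by apply/subsetP => o /ltO; rewrite inE.
apply: leq_fixed_cyc => i; rewrite !inE => /andP[/negPf iO /V].
by rewrite iO => /eqP.
Qed.

Section Step.

Variables (n : nat) (m : 'I_n) (O : {set 'I_n}).
Hypothesis ltO : forall o, o \in O -> (o < m)%N.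
Implicit Types (sigma tau : {perm 'I_n}).

Let mO : m \notin O.
Proof. by apply/negP => /ltO; rewrite ltnn. Qed.

Let leOm : (#|O| <= m)%N.
Proof.
rewrite -[leqRHS](card_ord_lt (ltnW (ltn_ord m))).
by apply/subset_leq_card/subsetP => o /ltO; rewrite inE.
Qed.

Let cardD1_out x : x \notin O -> #|O :\ x| = #|O|.
Proof. by rewrite [RHS](cardsD1 x) => /negPf->. Qed.

Let cardD1_in x : x \in O -> #|O :\ x| = #|O|.-1.
Proof. by rewrite [in RHS](cardsD1 x) => ->. Qed.

Let tail_weightS sigma tau : (forall j : 'I_n, (m < j)%N -> sigma j = tau j) ->
  tail_weight m sigma = weight sigma m * tail_weight m.+1 tau.
Proof.
move=> eq_st; rewrite /tail_weight (bigD1 m) //=; congr (_ * _).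
apply: eq_big => i; first by rewrite andbC -val_eqE /= ltn_neqAle eq_sym.
rewrite -val_eqE /= => /andP[lemi neqi]; apply: weight_local => j leij.
by apply: eq_st; move: neqi; lia.
Qed.

Lemma completions_valley :
  \sum_(sigma | [&& collapsed m O sigma, m < sigma m & m < (sigma^-1)%g m]%N)
     lambda ^+ (cyc sigma - (m - #|O|)) * tail_weight m sigma
  = up #|O| * completions m.+1 (m |: O).
Proof.
rewrite /completions big_distrr; apply: eq_big => sigma /=.
  exact: collapsed_valley.
case/and3P=> V ltm ltVm; rewrite (tail_weightS (tau := sigma)) //.
have -> : weight sigma m = up #|O|.
  rewrite /weight -val_eqE /= (gtn_eqF ltm) ltm ltVm (collapsed_depth ltO) //.
  by rewrite cardD1_out //; apply/negP => /ltO; rewrite ltnNge ltnW.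
by rewrite cardsU1 mO subSS mulrCA.
Qed.

Lemma completions_fixed :
  \sum_(sigma | collapsed m O sigma && (sigma m == m))
     lambda ^+ (cyc sigma - (m - #|O|)) * tail_weight m sigma
  = lambda * s ^+ #|O| * w #|O| * completions m.+1 O.
Proof.
rewrite /completions big_distrr; apply: eq_big => sigma /=.
  exact: collapsed_fixed.
move=> VS; have := VS; rewrite collapsed_fixed // => V1.
case/andP: VS => V /eqP fm; rewrite (tail_weightS (tau := sigma)) //.
have -> : weight sigma m = w #|O| * s ^+ #|O|.
  by rewrite /weight fm eqxx (collapsed_depth ltO) // fm cardD1_out.
have lec : (m.+1 - #|O| <= cyc sigma)%N.
  by apply: collapsed_cyc V1 => // o /ltO/ltnW.
rewrite (_ : cyc sigma - (m - #|O|) = (cyc sigma - (m.+1 - #|O|)).+1)%N;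
  last by lia.
by rewrite exprS !mulrA; congr (_ * _); move: (_ ^+ (_ - _)%N) => e; ring.
Qed.

Let collapsed_target sigma : collapsed m O sigma -> (sigma m < m)%N ->
  sigma m \in O.
Proof.
move=> /collapsedP V ltm; have := V _ ltm; case: ifP => // _.
by rewrite (inj_eq perm_inj) => /eqP eqm; move: ltm; rewrite eqm ltnn.
Qed.

Let collapsed_source sigma : collapsed m O sigma -> ((sigma^-1)%g m < m)%N ->
  (sigma^-1)%g m \in O.
Proof.
move=> /collapsedP V ltm; have := V _ ltm; rewrite permKV; case: ifP => // _.
by move=> /eqP eqm; move: ltm; rewrite -eqm ltnn.
Qed.

Lemma completions_drise :
  \sum_(sigma | [&& collapsed m O sigma, m < sigma m & (sigma^-1)%g m < m]%N)
     lambda ^+ (cyc sigma - (m - #|O|)) * tail_weight m sigma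
  = #|O|%:R * pp2 ^+ #|O|.-1 * y2 * completions m.+1 O.
Proof.
rewrite (partition_big (fun sigma => (sigma^-1)%g m) (mem O)) /=; last first.
  by move=> sigma /and3P[V _ ltVm]; exact: collapsed_source.
rewrite -!mulrA mulr_natl -sumr_const; apply: eq_bigr => a aO.
rewrite (reindex_inj (mulgI (tperm a m))) /completions !big_distrr.
have ltam := ltO aO; have neqam : a != m by rewrite -val_eqE /= ltn_eqF.
apply: eq_big => sigma /=.
  rewrite -(collapsed_drise ltO _ aO); case: eqP => [->|_];
    last by rewrite !andbF.
  by rewrite ltam !andbT.
case/andP => /and3P[V ltm _] eqa; have fm : sigma m = m.
  by move: eqa; rewrite perm_inv_eq permM tpermL => /eqP.
rewrite (tail_weightS (tau := sigma)); last first.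
  by move=> j ltmj; rewrite permM tpermD // -val_eqE /= ltn_eqF //; lia.
have -> : weight (tperm a m * sigma)%g m = y2 * pp2 ^+ #|O|.-1.
  rewrite /weight -val_eqE /= (gtn_eqF ltm) ltm (eqP eqa) ltnNge (ltnW ltam) /=.
  rewrite (collapsed_depth ltO) // cardD1_out //; apply/negP => /ltO.
  by rewrite ltnNge ltnW.
rewrite (cyc_tperm_fixed fm neqam) (subSn leOm) subSS.
by rewrite mulrCA -!mulrA mulrCA.
Qed.

(** The constant [c] stands for the total weight of the contracted
    permutations, which by induction does not depend on [b]. *)
Lemma completions_dfall (c : R) :
    (forall b, b \in O -> completions m.+1 (m |: O :\ b) = c) ->
  \sum_(sigma | [&& collapsed m O sigma, sigma m < m & m < (sigma^-1)%g m]%N)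
     lambda ^+ (cyc sigma - (m - #|O|)) * tail_weight m sigma
  = low_sum pm2 qm2 x2 u2 #|O| * c.
Proof.
move=> IH.
rewrite (partition_big (fun sigma : {perm 'I_n} => sigma m) (mem O)) /=;
  last first.
  by move=> sigma /and3P[V ltm _]; exact: collapsed_target.
rewrite /low_sum -(sum_by_rank O (low_weight pm2 qm2 x2 u2)) mulr_suml.
apply: eq_bigr => b bO; rewrite -(IH b bO).
rewrite (reindex_inj (mulgI (tperm m b))) /completions !big_distrr.
have ltbm := ltO bO; have neqmb : m != b by rewrite -val_eqE /= gtn_eqF.
apply: eq_big => sigma /=.
  rewrite -(collapsed_dfall ltO _ bO); case: (eqVneq _ b) => [->|_].
    by rewrite ltbm !andbT.
  by rewrite !andbF.
case/andP => /and3P[V ltm ltVm] /eqP eqb; have fb : sigma b = b.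
  by move: eqb; rewrite permM tpermL.
rewrite (tail_weightS (tau := sigma)); last first.
  by move=> j ltmj; rewrite permM tpermD // -val_eqE /= ltn_eqF //; lia.
rewrite /weight -val_eqE /= (ltn_eqF ltm) ltVm ltnNge (ltnW ltm) /=.
rewrite (collapsed_lcross ltO) // (collapsed_lnest ltO) // eqb.
rewrite (cyc_tperm_fixed fb neqmb) cardsU1 !inE (negPf mO) andbF cardD1_in //.
have -> : (true + #|O|.-1 = #|O|)%N by rewrite (cardsD1 b) bO.
by rewrite (subSn leOm) subSS mulrCA.
Qed.

(** Among the [#|O|] paths that can precede [m], the one with start [b] closes a
    cycle. *)
Lemma completions_peak (c : R) :
    (forall b, b \in O -> completions m.+1 (O :\ b) = c) ->
  \sum_(sigma | [&& collapsed m O sigma, sigma m < m & (sigma^-1)%g m < m]%N)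
     lambda ^+ (cyc sigma - (m - #|O|)) * tail_weight m sigma
  = down #|O| * c.
Proof.
move=> IH.
rewrite (partition_big (fun sigma : {perm 'I_n} => sigma m) (mem O)) /=;
  last first.
  by move=> sigma /and3P[V ltm _]; exact: collapsed_target.
rewrite /down /low_sum -(sum_by_rank O (low_weight pm1 qm1 x1 u1)).
rewrite mulr_sumr mulr_suml.
apply: eq_bigr => b bO; rewrite -(IH b bO).
rewrite (partition_big (fun sigma => (sigma^-1)%g m) (mem O)) /=; last first.
  by move=> sigma /andP[/and3P[V _ ltVm] _]; exact: collapsed_source.
have ltbm := ltO bO.
have -> : lambda + #|O|.-1%:R = \sum_(a in O) (if a == b then lambda else 1).
  rewrite (big_setD1 b) //= eqxx -(cardD1_in bO) -sumr_const; congr (_ + _).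
  by apply: eq_bigr => a; rewrite !inE => /andP[/negPf->].
rewrite !mulr_suml; apply: eq_bigr => a aO.
have ltam := ltO aO.
rewrite (reindex_inj (mulgI (tperm a m * tperm a b)%g)) /completions big_distrr.
apply: eq_big => sigma /=.
  rewrite -mulgA -(collapsed_peak ltO _ aO bO).
  set tau := (tperm a m * _)%g.
  case: (eqVneq (tau m) b) => [->|_]; last by rewrite !andbF.
  case: (eqVneq (tau^-1%g m) a) => [->|_]; last by rewrite !andbF.
  by rewrite ltbm ltam !andbT.
rewrite -mulgA => VV; have /and3P[V eqb eqa] :
    [&& collapsed m O (tperm a m * (tperm a b * sigma))%g,
      (tperm a m * (tperm a b * sigma))%g m == b
    & ((tperm a m * (tperm a b * sigma))^-1)%g m == a].
  by case/andP: VV => /andP[/and3P[-> _ _] ->] ->.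
have V1 : collapsed m.+1 (O :\ b) sigma.
  by rewrite -(collapsed_peak ltO _ aO bO) V eqb eqa.
have fb : sigma b = b.
  by move: eqb; rewrite !permM tpermR tpermL => /eqP.
have fm : sigma m = m.
  have /collapsedP/(_ m (leqnn _)) := V1.
  by rewrite !inE (negPf mO) andbF => /eqP.
rewrite (tail_weightS (tau := sigma)); last first.
  move=> j ltmj; have neq (i : 'I_n) : (i <= m)%N -> i != j.
    by rewrite -val_eqE /= => leim; rewrite ltn_eqF // (leq_ltn_trans leim).
  by rewrite !permM !tpermD ?neq // ltnW.
have [ltm ltVm] : ((tperm a m * (tperm a b * sigma))%g m < m)%N /\
    ((tperm a m * (tperm a b * sigma))^-1%g m < m)%N.
  by rewrite (eqP eqb) (eqP eqa).
rewrite /weight -val_eqE /= (ltn_eqF ltm) ![(m < _)%N]ltnNge.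
rewrite (ltnW ltm) (ltnW ltVm) /=.
rewrite (collapsed_lcross ltO) // (collapsed_lnest ltO) // (eqP eqb).
have lec : (m.+1 - #|O :\ b| <= cyc sigma)%N.
  by apply: collapsed_cyc V1 => // o; rewrite inE => /andP[_ /ltO/ltnW].
have cardO : #|O| = #|O :\ b|.+1 by rewrite (cardsD1 b) bO.
have cycE : (cyc (tperm a m * (tperm a b * sigma))%g - (m - #|O|)
    = (a == b) + (cyc sigma - (m.+1 - #|O :\ b|)))%N.
  have neqam : a != m by rewrite -val_eqE /= ltn_eqF.
  move: lec leOm; rewrite cardO.
  move: #|O :\ b| => k; case: (eqVneq a b) => [<-|neqab].
    rewrite tperm1 mul1g (cyc_tperm_fixed fm neqam).
    by move: (cyc _) => e /=; clear; lia.
  have fm' : (tperm a b * sigma)%g m = m.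
    by rewrite permM tpermD // -val_eqE /= ltn_eqF.
  rewrite (cyc_tperm_fixed fb neqab) (cyc_tperm_fixed fm' neqam).
  by move: (cyc _) => e /=; clear; lia.
rewrite cycE exprD (_ : lambda ^+ (a == b) = if a == b then lambda else 1).
  by rewrite mulrACA.
by case: eqP.
Qed.

Lemma completionsS c :
    (forall b, b \in O ->
       completions m.+1 (m |: O :\ b) = completions m.+1 O) ->
    (forall b, b \in O -> completions m.+1 (O :\ b) = c) ->
  completions m O = up #|O| * completions m.+1 (m |: O)
                    + level #|O| * completions m.+1 O + down #|O| * c.
Proof.
move=> eqO eqc; rewrite -(completions_peak eqc) /level 2!mulrDl.
rewrite -(completions_dfall eqO) -completions_drise -completions_fixed.
rewrite -completions_valley {1}/completions.
rewrite (bigID (fun sigma : {perm 'I_n} => sigma m == m)) /=.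
rewrite [X in _ + X = _](bigID (fun sigma : {perm 'I_n} => (sigma m < m)%N)) /=.
rewrite [X in _ + (X + _) = _](bigID (fun sigma => ((sigma^-1)%g m < m)%N)) /=.
rewrite [X in _ + (_ + X) = _](bigID (fun sigma => ((sigma^-1)%g m < m)%N)) /=.
have -> (a b d e f : R) : a + (b + d + (e + f)) = f + (d + e + a) + b by ring.
congr (_ + (_ + _ + _) + _); apply: eq_bigl => sigma;
  case: (collapsed m O sigma) => //=; have := perm_inv_eq sigma m m;
  rewrite -!val_eqE /=; case: (ltngtP m (sigma m));
  by case: (ltngtP m ((sigma^-1)%g m)).
Qed.

End Step.

(** By [completionsS], contracting one more index is a step of a Motzkin path
    whose height is the number of contracted paths; that the total weight
    depends on nothing else makes the induction work. *)
Lemma completions_motzkin n r m (O : {set 'I_n}) : (m + r)%N = n ->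
    (forall o, o \in O -> (o < m)%N) ->
  completions m O = motzkin up level down r #|O|.
Proof.
elim: r m O => [|r IHr] m O.
  rewrite addn0 => eqm _; rewrite /completions /=.
  have V0 sigma : collapsed m O sigma = (O == set0) && (sigma == 1%g).
    apply/collapsedP/andP => [V | [/eqP-> /eqP->] i _].
      have O0 : O = set0.
        apply/setP => i; rewrite inE; apply/negP => iO; have := V i.
        by rewrite iO eqm ltn_ord => /(_ isT); rewrite leqNgt ltn_ord.
      split; first exact/eqP.
      apply/eqP/permP => i; rewrite perm1; have := V i.
      by rewrite O0 inE eqm ltn_ord => /(_ isT)/eqP.
    by rewrite inE perm1.
  rewrite (eq_bigl _ _ V0) cards_eq0; case: eqP => [->|_] /=; last first.
    by rewrite big_pred0.
  rewrite big_pred1_eq cards0 subn0.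
  have -> : (cyc (1%g : {perm 'I_n}) - m = 0)%N.
    apply/eqP; rewrite subn_eq0 eqm -[leqRHS]card_ord.
    exact: leq_imset_card.
  by rewrite mul1r /tail_weight big_pred0 // => i; rewrite eqm leqNgt ltn_ord.
move=> eqn ltO; have ltmn : (m < n)%N by lia.
pose m' := Ordinal ltmn.
have mO : m' \notin O by apply/negP => /ltO /=; rewrite ltnn.
have IH (A : {set 'I_n}) : (forall o, o \in A -> (o < m.+1)%N) ->
    completions m.+1 A = motzkin up level down r #|A|.
  by apply: IHr; lia.
have ltO' o : o \in O -> (o < m.+1)%N by move/ltO/ltnW.
have cardD1 b : b \in O -> #|O :\ b| = #|O|.-1.
  by rewrite [in RHS](cardsD1 b) => ->.
pose c := motzkin up level down r #|O|.-1.
rewrite -[m]/(m' : nat) (completionsS (m := m') ltO (c := c)) /c.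
- rewrite !IH //= ?cardsU1 ?mO //.
  by move=> o /setU1P[->|/ltO']; rewrite ?leqnn.
- move=> b bO; rewrite !IH //.
    by rewrite cardsU1 !inE (negPf mO) andbF cardD1 // (cardsD1 b O) bO.
  by move=> o; rewrite !inE => /orP[/eqP->//|/andP[_ /ltO']].
- move=> b bO; rewrite IH ?cardD1 //.
  by move=> o; rewrite !inE => /andP[_ /ltO'].
Qed.

End Completions.

(** * Factorisation of the statistics *)

(** A bijection crosses the cut at [t] equally often in both directions. *)
Lemma card_cut n (sigma : {perm 'I_n}) (t : nat) :
  #|[set j : 'I_n | (j < t)%N && (t <= sigma j)%N]|
    = #|[set j : 'I_n | (t <= j)%N && (sigma j < t)%N]|.
Proof.
pose A := [set j : 'I_n | (j < t)%N].
pose B := [set j : 'I_n | (sigma j < t)%N].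
have cardAB : #|A| = #|B|.
  rewrite -(card_preimset A (@perm_inj _ sigma)).
  by apply: eq_card => j; rewrite !inE.
have -> : [set j : 'I_n | (j < t)%N && (t <= sigma j)%N] = A :\: B.
  by apply/setP => j; rewrite !inE -leqNgt andbC.
have -> : [set j : 'I_n | (t <= j)%N && (sigma j < t)%N] = B :\: A.
  by apply/setP => j; rewrite !inE -leqNgt.
by rewrite !cardsD cardAB setIC.
Qed.

Section Statistics.

Variables (n : nat) (sigma : {perm 'I_n}).
Implicit Types i j k l : 'I_n.

(** Both sides count the arrows that cross the cut at [i], the arrows from and
    to [i] being counted separately. *)
Lemma lev_depth i :
  (lev sigma i + ((sigma^-1)%g i < i) = depth sigma i + (sigma i < i))%N.
Proof.
have := card_cut sigma i.
rewrite (cardsD1 ((sigma^-1)%g i)) [in RHS](cardsD1 i).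
rewrite !inE permKV !leqnn andbT /=.
rewrite addnC => eqc; rewrite [RHS]addnC.
have -> : lev sigma i = #|[set j : 'I_n | (j < i)%N && (i <= sigma j)%N]
                           :\ (sigma^-1)%g i|.
  apply: eq_card => j; rewrite !inE eq_sym perm_inv_eq.
  rewrite [(i < sigma j)%N]ltn_neqAle.
  by rewrite -val_eqE eq_sym; case: (_ < _)%N; case: (_ == _).
rewrite eqc; congr (_ + _)%N; apply: eq_card => j; rewrite !inE.
by rewrite [(i < j)%N]ltn_neqAle -val_eqE eq_sym andbA.
Qed.

(** An arrow that goes down past a cut forces an arrow that goes up past it,
    whose source is a smaller index with a larger image. *)
Lemma record_antiexc i : (sigma i < i)%N -> record sigma i = false.
Proof.
move=> lti; apply/negbTE/negP => /forallP rec.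
have : (0 < #|[set j : 'I_n | (i <= j)%N && (sigma j < i)%N]|)%N.
  by apply/card_gt0P; exists i; rewrite inE leqnn.
rewrite -card_cut => /card_gt0P[j]; rewrite inE => /andP[ltj lej].
by have /implyP/(_ ltj) := rec j; lia.
Qed.

Lemma antirecord_exc i : (i < sigma i)%N -> antirecord sigma i = false.
Proof.
move=> lti; apply/negbTE/negP => /forallP rec.
have : (0 < #|[set j : 'I_n | (j < i.+1)%N && (i.+1 <= sigma j)%N]|)%N.
  by apply/card_gt0P; exists i; rewrite inE leqnn.
rewrite card_cut => /card_gt0P[j]; rewrite inE => /andP[ltj lej].
by have /implyP/(_ ltj) := rec j; lia.
Qed.

Lemma antirecord_antiexc i : (sigma i < i)%N ->
  antirecord sigma i = (lnest sigma i == 0)%N.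
Proof.
move=> lti; rewrite cards_eq0; apply/forallP/eqP => [rec | n0 j].
  apply/setP => j; rewrite !inE; apply/negP => /and3P[ltj _ ltsj].
  by have /implyP/(_ ltj) := rec j; lia.
apply/implyP => ltj; have /setP/(_ j) := n0; rewrite !inE ltj /= => /negbT nlt.
have neq : sigma i != sigma j :> nat.
  by rewrite val_eqE (inj_eq perm_inj) -val_eqE /= ltn_eqF.
rewrite ltn_neqAle neq leqNgt; apply: contra nlt => lts.
by rewrite lts (ltn_trans lts).
Qed.

(** The quadruplets that define a crossing or a nesting consist of two indices
    and their images; this counts them by one of the two indices. *)
Lemma card_pairs (T : finType) (p : pred T) (f : 'I_n -> 'I_n -> T)
    (g : T -> 'I_n * 'I_n) :
    (forall j i, g (f j i) = (j, i)) ->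
    (forall x, p x -> f (g x).1 (g x).2 = x) ->
  #|[set x | p x]| = \sum_(j : 'I_n) #|[set i | p (f j i)]|.
Proof.
move=> gK fK.
have -> : [set x | p x] = [set f y.1 y.2 | y in [set y | p (f y.1 y.2)]].
  apply/setP => x; rewrite inE; apply/idP/imsetP => [px | [y]].
    by exists (g x); rewrite ?inE fK.
  by rewrite inE => py ->.
rewrite card_imset => [|[j i] [j' i'] /= eqf]; last first.
  by rewrite -[LHS]gK -[RHS]gK eqf.
rewrite -sum1dep_card.
rewrite -(pair_big_dep xpredT (fun j i => p (f j i)) (fun _ _ => 1%N)) /=.
by apply: eq_bigr => j _; rewrite sum1dep_card.
Qed.

Lemma card_cond (P : pred 'I_n) (b : bool) :
  #|[set i | P i && b]| = if b then #|[set i | P i]| else 0%N.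
Proof.
case: b; first by apply: eq_card => i; rewrite !inE andbT.
by apply: eq_card0 => i; rewrite !inE andbF.
Qed.

Variable c : pred 'I_n.

(** For fixed [j], each [i < j] with [j < sigma i] yields a crossing or a
    nesting, according to whether [sigma i] is smaller or larger than
    [sigma j]. *)
Lemma upper_quads :
  (nquad (fun i j k l : 'I_n => [&& k == sigma i, l == sigma j & c j])
   + nquad (fun i j k l : 'I_n => [&& l == sigma i, k == sigma j & c j])
  = \sum_(j : 'I_n) if c j && (j < sigma j) then lev sigma j else 0)%N.
Proof.
rewrite /nquad (card_pairs (f := fun j i : 'I_n => (i, j, sigma i, sigma j))
  (g := fun x => (x.1.1.2, x.1.1.1))) //=; last first.
  by move=> [[[i j] k] l] /= /and5P[_ _ _ /eqP-> /andP[/eqP-> _]].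
rewrite (card_pairs (f := fun j i : 'I_n => (i, j, sigma j, sigma i))
  (g := fun x => (x.1.1.2, x.1.1.1))) //=; last first.
  by move=> [[[i j] k] l] /= /and5P[_ _ _ /eqP-> /andP[/eqP-> _]].
rewrite -big_split; apply: eq_bigr => j _ /=; rewrite /lev.
rewrite -card_cond -[RHS](cardsID [set i | (sigma i < sigma j)%N]).
congr (_ + _)%N; apply: eq_card => i; rewrite !inE !eqxx /= -?leqNgt;
  case: (c j); rewrite ?andbF // ?andbT.
  by apply/idP/idP; lia.
have [->|neq] := eqVneq i j; first by rewrite ltnn !andbF.
rewrite [(sigma j <= _)%N]leq_eqVlt val_eqE (inj_eq perm_inj).
rewrite eq_sym (negPf neq).
by apply/idP/idP; lia.
Qed.

Lemma lower_crossings :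
  (nquad (fun i j k l : 'I_n => [&& i == sigma k, j == sigma l & c k])
  = \sum_(k : 'I_n) if c k && (sigma k < k) then lcross sigma k else 0)%N.
Proof.
rewrite /nquad (card_pairs (f := fun k l : 'I_n => (sigma k, sigma l, k, l))
  (g := fun x => (x.1.2, x.2))) //=; last first.
  by move=> [[[i j] k] l] /= /and5P[_ _ _ /eqP-> /andP[/eqP-> _]].
apply: eq_bigr => k _; rewrite /lcross -card_cond; apply: eq_card => l.
rewrite !inE !eqxx /=; case: (c k); rewrite ?andbF // ?andbT /=.
by apply/idP/idP; lia.
Qed.

Lemma lower_nestings :
  (nquad (fun i j k l : 'I_n => [&& i == sigma l, j == sigma k & c k])
  = \sum_(k : 'I_n) if c k && (sigma k < k) then lnest sigma k else 0)%N.
Proof.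
rewrite /nquad (card_pairs (f := fun k l : 'I_n => (sigma l, sigma k, k, l))
  (g := fun x => (x.1.2, x.2))) //=; last first.
  by move=> [[[i j] k] l] /= /and5P[_ _ _ /eqP-> /andP[/eqP-> _]].
apply: eq_bigr => k _; rewrite /lnest -card_cond; apply: eq_card => l.
rewrite !inE !eqxx /=; case: (c k); rewrite ?andbF // ?andbT /=.
by apply/idP/idP; lia.
Qed.

Lemma psnestE :
  (psnest sigma = \sum_(j : 'I_n) if sigma j == j then lev sigma j else 0)%N.
Proof.
rewrite /psnest (card_pairs (f := fun j i : 'I_n => (i, j, sigma i))
  (g := fun x => (x.1.2, x.1.1))) //=; last first.
  by move=> [[i j] l] /= /and4P[_ _ _ /eqP->].
apply: eq_bigr => j _; rewrite /lev -card_cond; apply: eq_card => i.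
by rewrite !inE eqxx andbT /= andbA.
Qed.

End Statistics.

Section Factorisation.

Variables (R : comNzRingType) (x1 x2 y1 y2 u1 u2 : R) (w : nat -> R).
Variables (pp1 pp2 pm1 pm2 qm1 qm2 s : R).

Lemma expr_card (T : finType) (P : pred T) (x : R) :
  x ^+ #|[set i | P i]| = \prod_i x ^+ P i.
Proof.
rewrite -sum1dep_card expr_sum big_mkcond; apply: eq_bigr => i _.
by case: (P i).
Qed.

(** The summand, apart from the cycles.  The parameters [y1], [y2], [pp1] and
    [pp2] each occur twice, as in the theorem: so the exclusive records among
    the cycle valleys and double rises need not be told apart, and
    [upper_quads] applies. *)
Lemma stat_weight_prod n (sigma : {perm 'I_n}) :
  x1 ^+ eareccpeak sigma * x2 ^+ eareccdfall sigma
     * y1 ^+ ereccval sigma * y2 ^+ ereccdrise sigma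
     * u1 ^+ nrcpeak sigma * u2 ^+ nrcdfall sigma
     * y1 ^+ nrcval sigma * y2 ^+ nrcdrise sigma
     * wfix w sigma
     * pp1 ^+ ucrosscval sigma * pp2 ^+ ucrosscdrise sigma
     * pm1 ^+ lcrosscpeak sigma * pm2 ^+ lcrosscdfall sigma
     * pp1 ^+ unestcval sigma * pp2 ^+ unestcdrise sigma
     * qm1 ^+ lnestcpeak sigma * qm2 ^+ lnestcdfall sigma
     * s ^+ psnest sigma
  = \prod_i weight x1 x2 y1 y2 u1 u2 w pp1 pp2 pm1 pm2 qm1 qm2 s sigma i.
Proof.
(* Brings the upper crossings and nestings together. *)
have regroup (a b c d e f g h i j : R) :
    a * b * c * d * e * f * g * h * i * j
    = a * (b * f) * (c * g) * d * e * h * i * j by ring.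
rewrite {}regroup -!exprD.
rewrite (upper_quads sigma (fun j => j < (sigma^-1)%g j)%N).
rewrite (upper_quads sigma (fun j => (sigma^-1)%g j < j)%N).
rewrite [lcrosscpeak _](lower_crossings sigma (fun j => (sigma^-1)%g j < j)%N).
rewrite [lcrosscdfall _](lower_crossings sigma (fun j => j < (sigma^-1)%g j)%N).
rewrite [lnestcpeak _](lower_nestings sigma (fun j => (sigma^-1)%g j < j)%N).
rewrite [lnestcdfall _](lower_nestings sigma (fun j => j < (sigma^-1)%g j)%N).
rewrite psnestE /wfix big_mkcond !expr_card !expr_sum -!big_split /=.
apply: eq_bigr => i _.
have := lev_depth sigma i; have := perm_inv_eq sigma i i.
rewrite /weight /nrar /exantirecord /exrecord /cpeak /cval /cdfall /cdrise.
rewrite -!val_eqE /=.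
case: (ltngtP (sigma i) i) => [lti|lti|_];
  case: (ltngtP ((sigma^-1)%g i) i) => // _ _ levE.
- rewrite record_antiexc // antirecord_antiexc // /low_weight.
  by case: (lnest sigma i == 0%N); rewrite /= !(expr0, mulr1, mul1r).
- rewrite record_antiexc // antirecord_antiexc // /low_weight.
  by case: (lnest sigma i == 0%N); rewrite /= !(expr0, mulr1, mul1r).
- have -> : (depth sigma i).-1 = lev sigma i by move: levE => /=; lia.
  rewrite antirecord_exc //.
  by case: (record sigma i); rewrite /= !(expr0, mulr1, mul1r).
- rewrite (_ : depth sigma i = lev sigma i); last by move: levE => /=; lia.
  rewrite antirecord_exc //.
  by case: (record sigma i); rewrite /= !(expr0, mulr1, mul1r).
- rewrite (_ : depth sigma i = lev sigma i); last by move: levE => /=; lia.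
  by rewrite !(andbF, expr0, mulr1, mul1r).
Qed.

End Factorisation.

Unset Implicit Arguments.

Theorem theorem2p12 (R : comNzRingType)
    (x1 x2 y1 y2 u1 u2 : R) (w : nat -> R)
    (pp1 pp2 pm1 pm2 qm1 qm2 s lambda : R)
    (gamma beta : nat -> R)
    (gamma_0 : gamma 0%N = lambda * w 0%N)
    (gamma_n : forall n : nat, (1 <= n)%N ->
       gamma n = (pm2 ^+ n.-1 * x2 + qm2 * pqint pm2 qm2 n.-1 * u2)
                 + n%:R * pp2 ^+ n.-1 * y2 + lambda * s ^+ n * w n)
    (beta_n : forall n : nat, (1 <= n)%N ->
       beta n = (lambda + n.-1%:R)
                * (pm1 ^+ n.-1 * x1 + qm1 * pqint pm1 qm1 n.-1 * u1)
                * pp1 ^+ n.-1 * y1) :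
  has_Jfraction
    (Qhat x1 x2 y1 y2 u1 u2 y1 y2 w
          pp1 pp2 pm1 pm2 pp1 pp2 qm1 qm2 s lambda)
    gamma beta.
Proof.
pose lv := level x2 y2 u2 w pp2 pm2 qm2 s lambda.
pose dn := down x1 u1 pm1 qm1 lambda.
have gammaE : gamma =1 lv.
  case=> [|n]; last by rewrite gamma_n // /lv /level low_sumS.
  by rewrite gamma_0 /lv /level low_sum0 !mul0r !add0r mulr1.
have betaE k : beta k.+1 = up y1 pp1 k * dn k.+1.
  by rewrite beta_n // /dn /down low_sumS /up /=; ring.
have dn0 : dn 0%N = 0 by rewrite /dn /down low_sum0 mulr0.
have QE n : motzkin (up y1 pp1) lv dn n 0 =
    Qhat x1 x2 y1 y2 u1 u2 y1 y2 w pp1 pp2 pm1 pm2 pp1 pp2 qm1 qm2 s lambda n.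
  have no_open (o : 'I_n) : o \in set0 -> (o < 0)%N by rewrite inE.
  have := completions_motzkin x1 x2 y1 y2 u1 u2 w pp1 pp2 pm1 pm2 qm1 qm2 s
    lambda (add0n n) no_open.
  rewrite cards0 => <-; apply: eq_big => sigma.
    by apply/collapsedP.
  by rewrite sub0n subn0 stat_weight_prod mulrC.
move=> n; have [N0 cvgN] := motzkin_Jfraction gammaE betaE dn0 n.
by exists N0 => N /cvgN->.
Qed.
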